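(* Let $A\in\mathbb{C}^{n\times n}$ have rank $r$ and be given by a Hartwig–Spindelböck decomposition $$A=U\begin{bmatrix}\Sigma K&\Sigma L\\0&0\end{bmatrix}U^{*},$$ and let $X$ be a minimal rank weak Drazin inverse of $A$. Then $X$ can be expressed as $$X=U\begin{bmatrix}Z&W\\0&0\end{bmatrix}U^{*}$$ for some minimal rank weak Drazin inverse $Z$ of $\Sigma K$ and some $W\in\mathbb{C}^{r\times(n-r)}$ satisfying $\mathcal{R}(W)\subseteq\mathcal{R}(Z)$, and, with this $Z$, the following statements are equivalent: (1) $A^{\dagger}AXAA^{\dagger}=A^{\dagger}XA$; (2) $Z=(\Sigma K)^{D}$ and $(\Sigma K)^{D}\Sigma L=0$.
   Context: $A^{\dagger}$ is the Moore–Penrose inverse and $\mathcal{R}(\cdot)$ denotes the range. For a square matrix $B$, $\operatorname{ind}(B)$ is the smallest nonnegative integer $k$ such that $\operatorname{rank}(B^k)=\operatorname{rank}(B^{k+1})$, and $B^{D}$ is the Drazin inverse: the unique $T$ with $TBT=T$, $BT=TB$, $B^{k+1}T=B^k$ where $k=\operatorname{ind}(B)$. A square matrix $X$ is a minimal rank weak Drazin inverse of a square matrix $B$ of the same size if $XB^{k+1}=B^{k}$ for some $k\in\mathbb{N}$ and $\operatorname{rank}(X)=\operatorname{rank}(B^{D})$. For a fixed minimal rank weak Drazin inverse $X$ of $A$, $A^{\dagger}AXAA^{\dagger}$ is the weak CMP inverse of $A$ and $A^{\dagger}XA$ is the weak MPD inverse of $A$. Hartwig–Spindelböck decomposition: every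 $A\in\mathbb{C}^{n\times n}$ of rank $r$ can be written as $A=U\begin{bmatrix}\Sigma K&\Sigma L\\0&0\end{bmatrix}U^{*}$, where $U\in\mathbb{C}^{n\times n}$ is unitary, $\Sigma=\operatorname{diag}(\sigma_1I_{r_1},\ldots,\sigma_tI_{r_t})$ is the diagonal matrix of (nonzero) singular values of $A$, $\sigma_1>\cdots>\sigma_t>0$, $r_1+\cdots+r_t=r$, and $K\in\mathbb{C}^{r\times r}$, $L\in\mathbb{C}^{r\times(n-r)}$ satisfy $KK^{*}+LL^{*}=I_r$. *)

(* Defs.v *)
From mathcomp Require Import all_boot all_order all_algebra.
From mathcomp Require Import complex.
From mathcomp Require Import boolp classical_sets reals.

Set Implicit Arguments.
Unset Strict Implicit.
Unset Printing Implicit Defensive.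

Import Order.TTheory GRing.Theory Num.Theory.
Local Open Scope ring_scope.
Local Open Scope sesquilinear_scope.
Local Open Scope classical_set_scope.

Section Definitions.
Variable C : numClosedFieldType.

(* Not the library's (A <= B)%MS, which compares row spaces. *)
Definition colrange p q (M : 'M[C]_(p, q)) : set 'cV[C]_p :=
  range (fun x : 'cV[C]_q => M *m x).

Definition is_mpinv p q (A : 'M[C]_(p, q)) (T : 'M[C]_(q, p)) : Prop :=
  [/\ A *m T *m A = A,
      T *m A *m T = T,
      (A *m T) ^t* = A *m T
    & (T *m A) ^t* = T *m A].

Definition mpinv p q (A : 'M[C]_(p, q)) : 'M[C]_(q, p) :=
  xget 0 [set T | is_mpinv A T].

Lemma rank_stable n (B : 'M[C]_n) :
  exists k, \rank (B ^+ k) == \rank (B ^+ k.+1).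
Proof.
apply: contrapT => /forallNP H.
suff S j : (\rank (B ^+ j) + j <= n)%N.
  by have := S n.+1; rewrite leqNgt addnS ltnS leq_addl.
elim: j => [|j IH]; first by rewrite addn0 rank_leq_row.
apply: leq_trans IH; rewrite addnS -addSn leq_add2r ltn_neqAle.
rewrite exprS mxrankM_maxr andbT eq_sym -exprS; exact/negP.
Qed.

Definition ind n (B : 'M[C]_n) : nat := ex_minn (rank_stable B).

Definition is_drazin n (B T : 'M[C]_n) : Prop :=
  [/\ T *m B *m T = T,
      B *m T = T *m B
    & B ^+ (ind B).+1 *m T = B ^+ ind B].

Definition drazin n (B : 'M[C]_n) : 'M[C]_n :=
  xget 0 [set T | is_drazin B T].

Definition min_rank_weak_drazin n (B X : 'M[C]_n) : Prop :=
  (exists k : nat, X *m B ^+ k.+1 = B ^+ k) /\ \rank X = \rank (drazin B).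

(* S = diag(s_1 I_(d_1), ..., s_t I_(d_t)) with s_1 > ... > s_t > 0 and
   d_1 + ... + d_t = r; in C, 0 < s i also says that s i is real. *)
Definition is_sv_diag r (S : 'M[C]_r) : Prop :=
  exists (t : nat) (s : 'I_t -> C) (d : 'I_t -> nat)
         (e : (\sum_(i < t) d i)%N = r),
    [/\ forall i, 0 < s i,
        forall i j : 'I_t, (i < j)%N -> s j < s i,
        forall i, (0 < d i)%N
      & S = castmx (e, e) (\mxdiag_(i < t) (s i)%:M : 'M_(\sum_(i < t) d i))].

(* The entries of S are then the nonzero singular values of A, since
   A A^* = U diag(S^2, 0) U^*. *)
Definition hartwig_spindelbock r m (A U : 'M[C]_(r + m))
    (S K : 'M[C]_r) (L : 'M[C]_(r, m)) : Prop :=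
  [/\ U \is unitarymx,
      is_sv_diag S,
      K *m K ^t* + L *m L ^t* = 1%:M
    & A = U *m block_mx (S *m K) (S *m L) 0 0 *m U ^t*].

End Definitions.

Section Facts.
Variable C : numClosedFieldType.

Lemma trmxC_mul p q s (A : 'M[C]_(p, q)) (B : 'M[C]_(q, s)) :
  (A *m B) ^t* = B ^t* *m A ^t*.
Proof. by rewrite trmx_mul map_mxM. Qed.

Lemma mulmx_trC_eq0 q (w : 'rV[C]_q) : w *m w ^t* = 0 -> w = 0.
Proof.
move=> /matrixP/(_ 0 0); rewrite !mxE => /eqP; rewrite psumr_eq0.
  move=> /allP H; apply/rowP=> i; rewrite mxE; have := H i (mem_index_enum i).
  by rewrite !mxE /= -normCK expf_eq0 normr_eq0 => /eqP.
by move=> i _; rewrite !mxE -normCK exprn_ge0.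
Qed.

Lemma row_free_gram p q (G : 'M[C]_(p, q)) :
  row_free G -> G *m G ^t* \in unitmx.
Proof.
move=> fG; rewrite -row_free_unit; apply/inj_row_free => v vG.
have: v *m G = 0.
  by apply: mulmx_trC_eq0; rewrite trmxC_mul mulmxA -(mulmxA v) vG mul0mx.
by move/eqP; rewrite mulmx_free_eq0 // => /eqP.
Qed.

Lemma invmx_herm p (M : 'M[C]_p) : M ^t* = M -> (invmx M) ^t* = invmx M.
Proof. by move=> hM; rewrite trmx_inv map_invmx hM. Qed.

Lemma is_mpinv_ex p q (A : 'M[C]_(p, q)) : exists T, is_mpinv A T.
Proof.
have [u [F [G [FG uF uG]]]] : exists u (F : 'M[C]_(p, u)) (G : 'M[C]_(u, q)),
    [/\ F *m G = A, F ^t* *m F \in unitmx & G *m G ^t* \in unitmx].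
  exists (\rank A), (col_base A), (row_base A); split.
  - exact: mulmx_base.
  - rewrite -[X in _ *m X]trmxCK; apply: row_free_gram.
    by rewrite /row_free mxrank_map mxrank_tr; exact: col_base_full.
  - by apply: row_free_gram; exact: row_base_free.
have hG : (invmx (G *m G ^t*)) ^t* = invmx (G *m G ^t*).
  by apply: invmx_herm; rewrite trmxC_mul trmxCK.
have hF : (invmx (F ^t* *m F)) ^t* = invmx (F ^t* *m F).
  by apply: invmx_herm; rewrite trmxC_mul trmxCK.
pose T := G ^t* *m invmx (G *m G ^t*) *m invmx (F ^t* *m F) *m F ^t*.
have AT : A *m T = F *m invmx (F ^t* *m F) *m F ^t*.
  by rewrite -FG /T !mulmxA -(mulmxA F G) mulmxK.
have TA : T *m A = G ^t* *m invmx (G *m G ^t*) *m G.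
  by rewrite -FG /T !mulmxA -(mulmxA _ (F ^t*) F) mulmxKV.
exists T; split.
- by rewrite AT -FG !mulmxA -(mulmxA _ (F ^t*) F) mulmxKV.
- by rewrite TA /T !mulmxA -(mulmxA _ G (G ^t*)) mulmxKV.
- by rewrite AT !trmxC_mul trmxCK hF mulmxA.
- by rewrite TA !trmxC_mul trmxCK hG mulmxA.
Qed.

Lemma is_mpinv_uniq p q (A : 'M[C]_(p, q)) T1 T2 :
  is_mpinv A T1 -> is_mpinv A T2 -> T1 = T2.
Proof.
move=> [a1 b1 c1 d1] [a2 b2 c2 d2].
have e1 : A *m T1 = A *m T2.
  by rewrite -c1 -{1}a2 -(mulmxA _ A T1) trmxC_mul c1 c2 mulmxA a1.
have e2 : T1 *m A = T2 *m A.
  by rewrite -d1 -{1}a2 -mulmxA mulmxA trmxC_mul d1 d2 -mulmxA (mulmxA A) a1.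
by rewrite -b1 e2 -mulmxA e1 mulmxA.
Qed.

Lemma mpinvP p q (A : 'M[C]_(p, q)) : is_mpinv A (mpinv A).
Proof. exact: (xgetPex 0 (is_mpinv_ex A)). Qed.

Lemma mpinv_eq p q (A : 'M[C]_(p, q)) T : is_mpinv A T -> mpinv A = T.
Proof. by move=> h; apply: is_mpinv_uniq h; exact: mpinvP. Qed.

Lemma ind_rank n (B : 'M[C]_n) :
  \rank (B ^+ ind B) = \rank (B ^+ (ind B).+1).
Proof. by rewrite /ind; case: ex_minnP => k /eqP. Qed.

Lemma ind_min n (B : 'M[C]_n) k :
  \rank (B ^+ k) = \rank (B ^+ k.+1) -> (ind B <= k)%N.
Proof. by rewrite /ind; case: ex_minnP => j _ h /eqP/h. Qed.

Lemma ind_facl n (B : 'M[C]_n) j :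
  exists Y, B ^+ ind B = Y *m B ^+ (ind B + j).
Proof.
have [D hD] : exists D, B ^+ ind B = D *m B ^+ (ind B).+1.
  apply/submxP; rewrite -(geq_leqif (mxrank_leqif_sup _)).
    by rewrite ind_rank.
  by rewrite exprS submxMl.
elim: j => [|j [Y hY]]; first by exists 1%:M; rewrite addn0 mul1mx.
exists (Y *m D); rewrite {1}hY exprD hD !mulmxE.
by rewrite -!mulrA -exprD addSnnS.
Qed.

Lemma ind_facr n (B : 'M[C]_n) j :
  exists Z, B ^+ ind B = B ^+ (ind B + j) *m Z.
Proof.
have [D hD] : exists D, B ^+ ind B = B ^+ (ind B).+1 *m D.
  suff /submxP[D hD] : ((B ^+ ind B)^T <= (B ^+ (ind B).+1)^T)%MS.
    by exists D^T; rewrite -[LHS]trmxK hD trmx_mul trmxK.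
  rewrite -(geq_leqif (mxrank_leqif_sup _)).
    by rewrite !mxrank_tr ind_rank.
  by rewrite exprSr -mulmxE trmx_mul submxMl.
elim: j => [|j [Z hZ]]; first by exists 1%:M; rewrite addn0 mulmx1.
exists (D *m Z); rewrite !mulmxE in hD hZ *.
by rewrite addnS -addSn addnC exprD -mulrA (mulrA _ D) -hD mulrA -exprD addnC.
Qed.

Lemma is_drazin_ex n (B : 'M[C]_n) : exists T, is_drazin B T.
Proof.
set k := ind B.
have [Y hY] := ind_facl B k.+1; have [Z hZ] := ind_facr B k.+1.
rewrite -/k in hY hZ; rewrite !mulmxE in hY hZ.
have [T TZ] : exists T, T = B ^+ k * Z by exists (B ^+ k * Z).
have YT : T = Y * B ^+ k by rewrite TZ {1}hY -mulrA -hZ.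
have TB : T * B ^+ k.+1 = B ^+ k by rewrite YT -mulrA -exprD -hY.
have BT : B ^+ k.+1 * T = B ^+ k by rewrite TZ mulrA -exprD addSnnS -hZ.
have eT : B ^+ k.+1 = T * B * B * B ^+ k.
  by rewrite exprSr -{1}TB -mulrA -exprSr !exprS !mulrA.
have eB : B ^+ k.+1 = B ^+ k * B * B * T.
  by rewrite exprS -{1}BT mulrA -exprS !exprSr.
have c1 : B * T = T * B * B * T.
  have -> : B * T = B ^+ k.+1 * Z by rewrite TZ mulrA -exprS.
  by rewrite eT -!mulrA -TZ.
have c2 : T * B = T * B * B * T.
  transitivity (Y * B ^+ k.+1); first by rewrite YT -mulrA -exprSr.
  by rewrite eB !mulrA -YT.
exists T; rewrite /is_drazin !mulmxE; split; [|by rewrite c1 -c2 | exact: BT].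
by rewrite -(mulrA T) {2}TZ (mulrA B) -exprS mulrA TB -TZ.
Qed.

Lemma is_drazin_uniq n (B T1 T2 : 'M[C]_n) :
  is_drazin B T1 -> is_drazin B T2 -> T1 = T2.
Proof.
move=> [a1 b1 c1] [a2 b2 c2]; move: a1 b1 c1 a2 b2 c2.
rewrite !mulmxE; set k := ind B => a1 b1 c1 a2 b2 c2.
have p1 j : T1 = T1 ^+ j.+1 * B ^+ j.
  elim: j => [|j IH]; first by rewrite mulr1.
  by rewrite exprS (exprSr B) mulrA -(mulrA T1) -IH -mulrA -b1 mulrA a1.
have p2 j : T2 = B ^+ j * T2 ^+ j.+1.
  elim: j => [|j IH]; first by rewrite mul1r.
  by rewrite (exprSr T2) (exprS B) mulrA -(mulrA B) -IH b2 a2.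
have -> : T1 = T1 * B * T2.
  by rewrite {1}(p1 k) -c2 (exprSr B) !mulrA -(p1 k).
have e1 : T1 * B ^+ k.+1 = B ^+ k.
  rewrite -[RHS]c1.
  have : GRing.comm T1 (B ^+ k.+1) by apply: commrX; rewrite /GRing.comm -b1.
  by [].
by rewrite [RHS](p2 k) -e1 (exprS B) !mulrA -(mulrA _ (B ^+ k)) -(p2 k).
Qed.

Lemma drazinP n (B : 'M[C]_n) : is_drazin B (drazin B).
Proof. exact: (xgetPex 0 (is_drazin_ex B)). Qed.

Lemma drazin_eq n (B T : 'M[C]_n) : is_drazin B T -> drazin B = T.
Proof. by move=> h; apply: is_drazin_uniq h; exact: drazinP. Qed.

End Facts.

(* Main.v *)
Require Import Defs.
From mathcomp Require Import all_boot all_order all_algebra.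
From mathcomp Require Import complex.
From mathcomp Require Import boolp classical_sets reals.

Set Implicit Arguments.
Unset Strict Implicit.
Unset Printing Implicit Defensive.

Import Order.TTheory GRing.Theory Num.Theory.
Local Open Scope ring_scope.
Local Open Scope sesquilinear_scope.
Local Open Scope classical_set_scope.

(** Write A = V G with V the first r columns of U and G = (SK SL) U^*.  Then
    V^* V = 1 and G V = SK =: B, and rank A = r makes G right invertible, so
    that A^(k+1) = V B^k G.  A minimal rank weak Drazin inverse X of A factors
    on the left through every power of A, hence X = V (Z W) U^*, and the
    equation X A^(k+1) = A^k descends to Z and B.  Since A A^+ = V V^*,
    condition (1) says A X V V^* = X A, that is B Z = Z B and Z SL = 0; and a
    minimal rank weak Drazin inverse commuting with B is the Drazin inverse. *)

Section Drazin.
Variables (C : numClosedFieldType) (n : nat).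
Implicit Types B X : 'M[C]_n.

Lemma drazin_powl B k : drazin B = B ^+ k *m drazin B ^+ k.+1.
Proof.
have [TBT BT _] := drazinP B; move: TBT BT; rewrite !mulmxE => TBT BT.
elim: k => [|k IH]; first by rewrite mul1r.
by rewrite (exprSr (drazin B)) (exprS B) mulrA -(mulrA B) -IH BT TBT.
Qed.

Lemma mul_drazin_pow B k : (ind B <= k)%N -> drazin B *m B ^+ k.+1 = B ^+ k.
Proof.
have [_ BT BkT] := drazinP B; move: BT BkT; rewrite !mulmxE => BT BkT.
have TB : drazin B * B ^+ (ind B).+1 = B ^+ ind B.
  by rewrite -[RHS]BkT; apply: commrX; rewrite /GRing.comm BT.
by move=> /subnKC <-; rewrite -addSn exprD mulrA TB -exprD.
Qed.

(** [drazin B] and [B ^+ k] factor through each other on the left, so their column spaces agree. *)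
Lemma rank_drazin B k : (ind B <= k)%N -> \rank (drazin B) = \rank (B ^+ k).
Proof.
move=> le_k; apply/eqP; rewrite eqn_leq {1}(drazin_powl B k) mxrankM_maxl.
by rewrite -{1}(mul_drazin_pow le_k) mxrankM_maxl.
Qed.

Lemma weak_drazin_leq B X k j :
  X *m B ^+ k.+1 = B ^+ k -> (k <= j)%N -> X *m B ^+ j.+1 = B ^+ j.
Proof.
rewrite !mulmxE => XB /subnKC <-.
by rewrite -addSn exprD mulrA XB -exprD.
Qed.

(** Equal rank forces [X] and [X *m Q] to have the same column space. The proof transposes because
    [<=] on matrices compares row spaces. *)
Lemma mulmx_rank_eqr p q s (X : 'M[C]_(p, q)) (Q : 'M_(q, s)) :
  \rank (X *m Q) = \rank X -> exists Y, X = X *m Q *m Y.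
Proof.
move=> eq_rk; suff /submxP[Y XY] : (X^T <= (X *m Q)^T)%MS.
  by exists Y^T; rewrite -[LHS]trmxK XY trmx_mul trmxK.
rewrite -(geq_leqif (mxrank_leqif_sup _)) ?mxrank_tr ?eq_rk //.
by rewrite trmx_mul submxMl.
Qed.

Lemma min_rank_weak_drazin_powl B X k :
  min_rank_weak_drazin B X -> exists Y, X = B ^+ k *m Y.
Proof.
(* The exponent [j] is above [ind B] for the rank, above [k0] for the weak equation, and leaves a
   factor [B ^+ k] to split off. *)
move=> [[k0 XB] rX]; pose j := (ind B + k0 + k)%N.
have XBj : X *m B ^+ j.+1 = B ^+ j.
  by apply: weak_drazin_leq XB _; rewrite /j addnAC leq_addl.
have [|Y XY] := @mulmx_rank_eqr _ _ _ X (B ^+ j.+1).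
  by rewrite XBj rX (@rank_drazin B j) // /j -addnA leq_addr.
exists (B ^+ (ind B + k0) *m Y).
by rewrite mulmxA {1}XY XBj !mulmxE -exprD addnC.
Qed.

Lemma min_rank_weak_drazin_commute B X :
  min_rank_weak_drazin B X -> B *m X = X *m B -> X = drazin B.
Proof.
move=> minX BX; have [[k XB] _] := minX.
have [Y XY] := min_rank_weak_drazin_powl k minX.
(* The weak equation is only known from exponent [k] on; the factor [V] brings it from [ind B + k]
   down to [ind B]. *)
have [V BV] := ind_facr B k.
have BS j : B *m B ^+ j = B ^+ j.+1 by rewrite exprS.
apply/esym/drazin_eq; split=> //.
  by rewrite {2}XY mulmxA -(mulmxA X) BS XB -XY.
have -> : B ^+ (ind B).+1 *m X = X *m B ^+ (ind B).+1.
  by apply/esym; apply: (@commrX _ X B); rewrite /GRing.comm -!mulmxE BX.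
have XBk := weak_drazin_leq XB (leq_addl (ind B) k).
by rewrite -BS {1}BV (mulmxA B) BS mulmxA XBk -BV.
Qed.

End Drazin.

Section FullRankFactor.
Variables (C : numClosedFieldType) (r n : nat).
Variables (A : 'M[C]_n) (V : 'M[C]_(n, r)) (G : 'M[C]_(r, n)).
Hypotheses (AVG : A = V *m G) (VV : V ^t* *m V = 1%:M) (freeG : row_free G).

Lemma pow_full_rank_factor k : A ^+ k.+1 = V *m (G *m V) ^+ k *m G.
Proof.
elim: k => [|k IH]; first by rewrite expr1 mulmx1.
by rewrite (exprSr _ k.+1) IH {}AVG (exprSr _ k) -!mulmxE !mulmxA.
Qed.

(** Both sides are the orthogonal projector onto the range of [A], for which the columns of [V] form
    an orthonormal basis. *)
Lemma mul_mpinv_full_rank_factor : A *m mpinv A = V *m V ^t*.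
Proof.
have [] := mpinvP A; move defP: (A *m mpinv A) => P AA _ hP _.
have PV : P *m V = V.
  by apply: (row_free_inj freeG); rewrite /= -mulmxA -AVG AA.
have VVA : V *m V ^t* *m A = A.
  by rewrite AVG mulmxA -(mulmxA V) VV mulmx1.
have PVV : P *m (V *m V ^t*) = V *m V ^t* by rewrite mulmxA PV.
(* As both projectors are Hermitian, this gives V V^* P = V V^*, while [VVA] gives V V^* P = P. *)
move/(congr1 (fun M => M ^t*)): PVV.
by rewrite !trmxC_mul trmxCK hP -{1}defP mulmxA VVA defP.
Qed.

Variables (X : 'M[C]_n) (minX : min_rank_weak_drazin A X).
Let B := G *m V.
Let Z := V ^t* *m X *m V.

Lemma full_rank_factor_left : X = V *m (V ^t* *m X).
Proof.
have [Y ->] := min_rank_weak_drazin_powl 1 minX.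
by rewrite expr1 AVG !mulmxA -(mulmxA V (V ^t*)) VV mulmx1.
Qed.

(** Writing A^(k+1) = V B^k G costs one exponent; then [G] cancels on the right and V^* removes [V]
    on the left. *)
Lemma full_rank_factor_weak_drazin k :
  X *m A ^+ k.+2 = A ^+ k.+1 -> Z *m B ^+ k.+1 = B ^+ k.
Proof.
rewrite !pow_full_rank_factor -/B mulmxA => /(row_free_inj freeG) XV.
by rewrite /Z -(mulmxA _ V) -mulmxA XV mulmxA VV mul1mx.
Qed.

(** With X = A^(k+1) Y one gets V^* X = B^k G Y, and B^k = Z B^(k+1). This yields the range
    inclusion for [W]. *)
Lemma full_rank_factor_col : exists Y, V ^t* *m X = Z *m Y.
Proof.
have [[k XA] _] := minX.
have ZB := full_rank_factor_weak_drazin (weak_drazin_leq XA (leqnSn k)).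
have [Y XY] := min_rank_weak_drazin_powl k.+1 minX.
exists (B ^+ k.+1 *m (G *m Y)).
rewrite mulmxA ZB {1}XY pow_full_rank_factor -/B.
by rewrite !mulmxA VV mul1mx.
Qed.

Lemma full_rank_factor_min_rank : min_rank_weak_drazin B Z.
Proof.
have [[k XA] rX] := minX.
have ZB := full_rank_factor_weak_drazin (weak_drazin_leq XA (leqnSn k)).
split; first by exists k.
pose j := (ind A + ind B + k)%N.
have ZBj : Z *m B ^+ j.+1 = B ^+ j by apply: weak_drazin_leq ZB (leq_addl _ _).
have le_jB : (ind B <= j)%N by rewrite /j addnAC leq_addl.
have le_jA : (ind A <= j.+1)%N by rewrite /j -addnA leqW ?leq_addr.
(* One bound is B^j = Z B^(j+1); the other is rank Z <= rank X = rank A^(j+1) <= rank B^j. *)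
apply/eqP; rewrite eqn_leq (rank_drazin le_jB) -{2}ZBj mxrankM_maxl andbT.
apply: (@leq_trans (\rank X)).
  by rewrite (leq_trans (mxrankM_maxl _ _)) ?mxrankM_maxr.
rewrite rX (rank_drazin le_jA) pow_full_rank_factor.
by rewrite (leq_trans (mxrankM_maxl _ _)) ?mxrankM_maxr.
Qed.

Lemma weak_cmp_eq_mpd :
  mpinv A *m A *m X *m A *m mpinv A = mpinv A *m X *m A <->
  B *m Z *m V ^t* = Z *m G.
Proof.
have [AA _ _ _] := mpinvP A; have AP := mul_mpinv_full_rank_factor.
have AXP : A *m X *m (A *m mpinv A) = V *m (B *m Z *m V ^t*).
  by rewrite AP AVG {1}full_rank_factor_left /B /Z !mulmxA.
have XA : X *m A = V *m (Z *m G).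
  by rewrite {1}full_rank_factor_left {1}AVG /Z !mulmxA.
split=> [eq1 | eqB].
  (* Left multiplication by [A] loses nothing: A A^+ = V V^* fixes [X], whose range lies in that of
     [V]. *)
  have : A *m X *m (A *m mpinv A) = X *m A.
    have := congr1 (mulmx A) eq1.
    by rewrite !mulmxA AA AP -(mulmxA _ _ X) -full_rank_factor_left.
  rewrite AXP XA => /(congr1 (mulmx (V ^t*))).
  by rewrite !(mulmxA (V ^t*)) VV !mul1mx.
by rewrite -[RHS]mulmxA XA -eqB -AXP !mulmxA.
Qed.

End FullRankFactor.

Lemma mul_block_mx0d (C : numClosedFieldType) r m (U U' : 'M[C]_(r + m))
    (P : 'M_r) (Q : 'M_(r, m)) :
  U *m block_mx P Q 0 0 *m U' =
  U *m col_mx 1%:M 0 *m (row_mx P Q *m U').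
Proof.
rewrite [RHS]mulmxA -[in RHS](mulmxA U) mul_col_row.
by rewrite !mul1mx !mul0mx.
Qed.

Lemma hartwig_spindelbock_weak_drazin (C : numClosedFieldType) (r m : nat)
    (A U X : 'M[C]_(r + m)) (S K : 'M[C]_r) (L : 'M[C]_(r, m)) :
  \rank A = r -> hartwig_spindelbock A U S K L -> min_rank_weak_drazin A X ->
  exists (Z : 'M[C]_r) (W : 'M[C]_(r, m)),
    [/\ X = U *m block_mx Z W 0 0 *m U ^t*,
        min_rank_weak_drazin (S *m K) Z,
        colrange W `<=` colrange Z
      & mpinv A *m A *m X *m A *m mpinv A = mpinv A *m X *m A <->
        Z = drazin (S *m K) /\ drazin (S *m K) *m (S *m L) = 0].
Proof.
move=> rankA [uU _ _ eA] minX.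
have UU : U *m U ^t* = 1%:M by apply/unitarymxP.
have UU' : U ^t* *m U = 1%:M by apply: mulmx1C.
pose V := U *m col_mx 1%:M 0; pose G := row_mx (S *m K) (S *m L) *m U ^t*.
have AVG : A = V *m G by rewrite eA mul_block_mx0d.
have Vt : V ^t* = row_mx 1%:M 0 *m U ^t*.
  by rewrite /V trmxC_mul tr_col_mx map_row_mx trmx1 trmx0 map_mx1 map_mx0.
have VV : V ^t* *m V = 1%:M.
  rewrite Vt /V mulmxA -(mulmxA _ (U ^t*)) UU' mulmx1 mul_row_col.
  by rewrite mulmx1 mul0mx addr0.
(* [G] has r rows, and r = rank (V G) <= rank G. *)
have freeG : row_free G.
  rewrite /row_free eqn_leq rank_leq_row -{1}rankA AVG.
  exact: mxrankM_maxr.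
have GV : G *m V = S *m K.
  rewrite /G /V mulmxA -(mulmxA _ (U ^t*)) UU' mulmx1 mul_row_col.
  by rewrite mulmx1 mulmx0 addr0.
pose Z := V ^t* *m X *m V.
pose W := V ^t* *m X *m (U *m col_mx 0 1%:M).
have ZW : row_mx Z W = V ^t* *m X *m U.
  rewrite /Z /W /V -!mul_mx_row.
  by rewrite -block_mxEh -scalar_mx_block mulmx1.
have minZ : min_rank_weak_drazin (S *m K) Z.
  rewrite -GV; exact (full_rank_factor_min_rank AVG VV freeG minX).
exists Z, W; split=> //.
- rewrite mul_block_mx0d -/V ZW -(mulmxA _ U) UU mulmx1.
  exact (full_rank_factor_left AVG VV minX).
- have [Y VXY] := full_rank_factor_col AVG VV freeG minX.
  move=> _ [x _ <-]; exists (Y *m (U *m col_mx 0 1%:M) *m x) => //.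
  by rewrite /W VXY !mulmxA.
apply: iff_trans (weak_cmp_eq_mpd AVG VV freeG minX) _.
rewrite GV -/Z Vt.
have -> : S *m K *m Z *m (row_mx 1%:M 0 *m U ^t*) =
          row_mx (S *m K *m Z) 0 *m U ^t*.
  by rewrite mulmxA mul_mx_row mulmx1 mulmx0.
have -> : Z *m G = row_mx (Z *m (S *m K)) (Z *m (S *m L)) *m U ^t*.
  by rewrite /G mulmxA mul_mx_row.
(* Cancelling U^* on the right lets the two blocks be compared: [Z] commutes with [S *m K] and kills
   [S *m L]. *)
clearbody Z; split=> [/(congr1 (mulmx^~ U)) | [eZ ZL]].
  rewrite -!(mulmxA _ (U ^t*)) UU' !mulmx1 => /eq_row_mx[BZ /esym ZL].
  have eZ : Z = drazin (S *m K).
    by apply: min_rank_weak_drazin_commute.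
  by rewrite -eZ.
have [_ BT _] := drazinP (S *m K).
by rewrite eZ ZL BT.
Qed.

Theorem proposition3p4 (R : realType) (r m : nat)
    (A U X : 'M[R[i]]_(r + m)) (S K : 'M[R[i]]_r) (L : 'M[R[i]]_(r, m))
    (rankA : \rank A = r)
    (decA : hartwig_spindelbock A U S K L)
    (minX : min_rank_weak_drazin A X) :
  exists (Z : 'M[R[i]]_r) (W : 'M[R[i]]_(r, m)),
    [/\ X = U *m block_mx Z W 0 0 *m U ^t*,
        min_rank_weak_drazin (S *m K) Z,
        colrange W `<=` colrange Z
      & mpinv A *m A *m X *m A *m mpinv A = mpinv A *m X *m A <->
        Z = drazin (S *m K) /\ drazin (S *m K) *m (S *m L) = 0].
Proof. exact: hartwig_spindelbock_weak_drazin rankA decA minX. Qed.
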